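(* Assume Gap-ETH: there exist constants $\delta,\gamma>0$ such that, given a MAX-3-SAT instance $\phi$ on $n$ variables, no $O(2^{\delta n})$-time algorithm can distinguish between the case $\mathrm{sat}(\phi)=1$ and the case $\mathrm{sat}(\phi)\le1-\gamma$. Then there exists $\epsilon_0=\epsilon_0(\delta,\gamma)>0$ such that for all $\epsilon\le\epsilon_0$ there is no polynomial-time algorithm for MAX-3-SAT which, given a satisfiable instance and subset advice with parameter $\epsilon$, returns a solution satisfying at least a $(1-\gamma)$-fraction of the clauses.
   Context: MAX-3-SAT: given a CNF formula whose clauses have at most $3$ literals, maximize the number of satisfied clauses. $\mathrm{sat}(\phi)$ denotes the maximum fraction of clauses of $\phi$ simultaneously satisfiable. Subset advice with parameter $\epsilon$: a subset $S$ of variable indices, each included independently with probability $\epsilon$, together with the values on $S$ of a fixed optimal (here satisfying) assignment. *)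

(* Defs.v *)
From mathcomp Require Import all_boot all_order all_algebra.
From mathcomp Require Import boolp reals exp.

Set Implicit Arguments.
Unset Strict Implicit.
Unset Printing Implicit Defensive.

Import Order.TTheory GRing.Theory Num.Theory.
Local Open Scope ring_scope.

(* Model of computation: the WHILE language over binary trees (N. D. Jones,
   "Computability and Complexity: From a Programming Perspective"), with its
   unit-cost measure: one step per expression or command constructor evaluated.
   It simulates, and is simulated by, multitape Turing machines with polynomial
   overhead.  Trees can only be inspected by [Hd], [Tl] and the test "is it a
   leaf", so that no operation hides more than a constant amount of work when
   trees are represented by pointers. *)

Inductive tree := Leaf | Node of tree & tree.

Fixpoint tree_size (t : tree) : nat :=
  if t is Node l r then (tree_size l + tree_size r).+1 else 1%N.

Inductive expr :=
| Var of nat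
| Nil
| Cons of expr & expr
| Hd of expr
| Tl of expr.

Inductive cmd :=
| Assign of nat & expr
| Seq of cmd & cmd
| If of expr & cmd & cmd
| While of expr & cmd.

Definition store := nat -> tree.

Definition upd (s : store) (x : nat) (v : tree) : store :=
  fun y => if y == x then v else s y.

Fixpoint eval (s : store) (e : expr) : tree :=
  match e with
  | Var x => s x
  | Nil => Leaf
  | Cons e1 e2 => Node (eval s e1) (eval s e2)
  | Hd e1 => if eval s e1 is Node l _ then l else Leaf
  | Tl e1 => if eval s e1 is Node _ r then r else Leaf
  end.

Fixpoint expr_cost (e : expr) : nat :=
  match e with
  | Var _ | Nil => 1
  | Cons e1 e2 => (expr_cost e1 + expr_cost e2).+1
  | Hd e1 | Tl e1 => (expr_cost e1).+1
  end.

(* [exec c s t s']: from store [s], [c] halts in [t] steps with store [s'].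
   [Leaf] is false in tests, every other tree is true. *)
Inductive exec : cmd -> store -> nat -> store -> Prop :=
| exec_assign x e s :
    exec (Assign x e) s (expr_cost e).+1 (upd s x (eval s e))
| exec_seq c1 c2 s1 t1 s2 t2 s3 :
    exec c1 s1 t1 s2 -> exec c2 s2 t2 s3 ->
    exec (Seq c1 c2) s1 (t1 + t2).+1 s3
| exec_if_true e c1 c2 s t s' :
    eval s e <> Leaf -> exec c1 s t s' ->
    exec (If e c1 c2) s (expr_cost e + t).+1 s'
| exec_if_false e c1 c2 s t s' :
    eval s e = Leaf -> exec c2 s t s' ->
    exec (If e c1 c2) s (expr_cost e + t).+1 s'
| exec_while_false e c s :
    eval s e = Leaf -> exec (While e c) s (expr_cost e).+1 s
| exec_while_true e c s1 t1 s2 t2 s3 :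
    eval s1 e <> Leaf -> exec c s1 t1 s2 -> exec (While e c) s2 t2 s3 ->
    exec (While e c) s1 (expr_cost e + t1 + t2).+1 s3.

(* Input and output are in variable 0; the other variables start at [Leaf]. *)
Definition computes (A : cmd) (input : tree) (t : nat) (output : tree) : Prop :=
  exists s, exec A (upd (fun=> Leaf) 0%N input) t s /\ s 0%N = output.

(* Clauses may contain repeated or complementary literals and may be empty;
   a formula is a list of clauses, counted with multiplicity. *)

Definition literal (n : nat) : Type := ('I_n * bool)%type.
Definition clause (n : nat) : Type := 3.-bseq (literal n).
Definition cnf3 (n : nat) : Type := seq (clause n).
Definition assignment (n : nat) : Type := {ffun 'I_n -> bool}.

Definition clause_sat n (a : assignment n) (c : clause n) : bool :=
  has (fun l : literal n => a l.1 == l.2) c.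

(* The empty formula counts as satisfied (fraction 1). *)
Definition frac (R : realType) n (a : assignment n) (phi : cnf3 n) : R :=
  if nilp phi then 1 else (count (clause_sat a) phi)%:R / (size phi)%:R.

(* The default 0 of the iterated maximum is harmless, fractions being >= 0. *)
Definition sat (R : realType) n (phi : cnf3 n) : R :=
  \big[Num.max/0]_(a : {ffun 'I_n -> bool}) frac R a phi.

(* Numbers, including variable indices and the number of variables, are encoded
   in unary; this changes input lengths only polynomially since assignments
   have length n anyway. *)

Definition enc_bool (b : bool) : tree := if b then Node Leaf Leaf else Leaf.

Definition enc_seq (ts : seq tree) : tree := foldr Node Leaf ts.

Definition enc_nat (k : nat) : tree := enc_seq (nseq k Leaf).

Definition enc_option_bool (o : option bool) : tree :=
  if o is Some b then Node Leaf (enc_bool b) else Leaf.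

Definition enc_literal n (l : literal n) : tree :=
  Node (enc_nat l.1) (enc_bool l.2).

Definition enc_clause n (c : clause n) : tree :=
  enc_seq [seq enc_literal l | l <- c].

Definition enc_cnf n (phi : cnf3 n) : tree :=
  Node (enc_nat n) (enc_seq [seq enc_clause c | c <- phi]).

Definition enc_assignment n (a : assignment n) : tree :=
  enc_seq [seq enc_bool (a i) | i <- enum 'I_n].

(* Advice: [Some b] at the indices of S, with b the value there, and [None] at
   the other indices. *)
Definition advice (n : nat) : Type := {ffun 'I_n -> option bool}.

Definition subset_advice n (a : assignment n) (S : {set 'I_n}) : advice n :=
  [ffun i => if i \in S then Some (a i) else None].

Definition enc_input n (phi : cnf3 n) (w : advice n) : tree :=
  Node (enc_cnf phi) (enc_seq [seq enc_option_bool (w i) | i <- enum 'I_n]).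

(* Probability of the event [E] for a random subset S of the n indices that
   contains each index independently with probability [eps]. *)
Definition subset_prob (R : realType) (eps : R) n (E : {set 'I_n} -> Prop) : R :=
  \sum_(S : {set 'I_n} | `[< E S >]) eps ^+ #|S| * (1 - eps) ^+ (n - #|S|).

(* An O(2^(delta n))-time algorithm telling sat = 1 from sat <= 1 - gamma.
   The number of clauses is not bounded by a function of n, as clauses can be
   repeated, whereas the running time is: without a bound on the number of
   clauses there would not even be time to read the input.  The time bound is
   therefore asked on every polynomially bounded class of instances, the
   constant in the O depending on the class. *)
Definition gap_algorithm (R : realType) (delta gamma : R) (A : cmd) : Prop :=
  forall c : nat, exists K : R,
  forall (n : nat) (phi : cnf3 n), (size phi <= c * n.+1 ^ c)%N ->
  exists (t : nat) (output : tree),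
    [/\ computes A (enc_cnf phi) t output,
        t%:R <= K * 2 `^ (delta * n%:R),
        sat R phi = 1 -> output = enc_bool true
      & sat R phi <= 1 - gamma -> output = enc_bool false].

Definition gap_ETH (R : realType) (delta gamma : R) : Prop :=
  ~ exists A : cmd, gap_algorithm delta gamma A.

Definition polytime_with_advice (A : cmd) : Prop :=
  exists k : nat, forall (n : nat) (phi : cnf3 n) (w : advice n),
  exists (t : nat) (output : tree),
    computes A (enc_input phi w) t output /\
    (t <= k * tree_size (enc_input phi w) ^ k)%N.

Definition returns_fraction (R : realType) (A : cmd) n (phi : cnf3 n)
    (w : advice n) (r : R) : Prop :=
  exists (t : nat) (b : assignment n),
    computes A (enc_input phi w) t (enc_assignment b) /\ r <= frac R b phi.

(* On every satisfiable instance, and for every optimal assignment [a] fixed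
   before S is drawn, [A] succeeds with probability at least [p] over S. *)
Definition solves_with_subset_advice (R : realType) (gamma eps p : R)
    (A : cmd) : Prop :=
  forall (n : nat) (phi : cnf3 n), sat R phi = 1 ->
  forall a : assignment n, frac R a phi = sat R phi ->
    p <= subset_prob eps
           (fun S => returns_fraction A phi (subset_advice a S) (1 - gamma)).

(* Main.v *)
Require Import Defs.
From mathcomp Require Import all_boot all_order all_algebra.
From mathcomp Require Import boolp reals exp.
From mathcomp Require Import zify ring lra.

Set Implicit Arguments.
Unset Strict Implicit.
Unset Printing Implicit Defensive.

Import Order.TTheory GRing.Theory Num.Theory.
(* Restores [Nil] and [Cons] of [expr], shadowed by those of [seq]. *)
Import Defs.

(** If [A] solves satisfiable instances from subset advice, trying all advice
    strings with few revealed values decides the gap problem: a random subset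
    has at most [n / r + O(1)] elements except with probability less than [p],
    and there are only [2 ^ (delta n / 4)] such strings up to a constant when
    [r] is large.  Two difficulties remain: [A] only guarantees the fraction
    [1 - gamma], which is also allowed in the other case of the gap problem, and
    [gamma] may be uncomputable.  Both disappear when one first guesses a partial
    assignment [tau], the restriction of the satisfying assignment to a block
    of at most [n / r + 1] variables that already satisfies a fraction [1 / r]
    of the clauses, and runs [A] on the formula restricted by [tau].  At most a
    fraction [gamma (1 - 1 / r)] of all clauses is then left unsatisfied, and
    acceptance is decided by comparison with a rational [P / D] strictly below
    [gamma] and at least [gamma (1 - 1 / r)]. *)

(** * Reasoning about WHILE programs *)

(** The time bound and the success guarantee each provide a run of [A]; determinism makes their
    outputs agree. *)
Lemma exec_det c s t s' : exec c s t s' ->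
  forall t2 s2, exec c s t2 s2 -> s2 = s'.
Proof.
elim=> {c s t s'}.
- by move=> x e s t2 s2 H; inversion H.
- move=> c1 c2 s1 t1 s2 t2 s3 _ IH1 _ IH2 t s H; inversion H; subst.
  match goal with h1 : exec c1 _ _ _, h2 : exec c2 _ _ _ |- _ =>
    by move: h2; rewrite (IH1 _ _ h1) => /IH2 end.
- move=> e c1 c2 s t s' he _ IH t2 s2 H; inversion H; subst => //.
  by match goal with h : exec c1 _ _ _ |- _ => exact: IH h end.
- move=> e c1 c2 s t s' he _ IH t2 s2 H; inversion H; subst => //.
  by match goal with h : exec c2 _ _ _ |- _ => exact: IH h end.
- by move=> e c s he t2 s2 H; inversion H; subst.
- move=> e c s1 t1 s2 t2 s3 he _ IH1 _ IH2 t s H; inversion H; subst => //.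
  match goal with h1 : exec c _ _ _, h2 : exec (While e c) _ _ _ |- _ =>
    by move: h2; rewrite (IH1 _ _ h1) => /IH2 end.
Qed.

Fixpoint assigned (c : cmd) : seq nat :=
  match c with
  | Assign x _ => [:: x]
  | Seq c1 c2 | If _ c1 c2 => assigned c1 ++ assigned c2
  | While _ c => assigned c
  end.

Lemma exec_frame c s t s' x : exec c s t s' -> x \notin assigned c -> s' x = s x.
Proof.
elim=> {c s t s'} //=.
- by move=> y e s; rewrite inE /upd; case: eqP.
- by move=> ? ? ? ? ? ? ? _ IH1 _ IH2; rewrite mem_cat negb_or => /andP[/IH1 <- /IH2].
- by move=> ? ? ? ? ? ? _ _ IH1; rewrite mem_cat negb_or => /andP[/IH1 <-].
- by move=> ? ? ? ? ? ? _ _ IH1; rewrite mem_cat negb_or => /andP[_ /IH1 <-].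
- by move=> ? ? ? ? ? ? ? _ _ IH1 _ IH2 h; rewrite (IH2 h) (IH1 h).
Qed.

Definition runs (c : cmd) (s : store) (T : nat) (Q : store -> Prop) : Prop :=
  exists t s', [/\ exec c s t s', t <= T & Q s'].

(** Consequence rule with the frame property built in, so that postconditions mention only what
    changes. *)
Lemma runs_conseq c s T T' (Q Q' : store -> Prop) :
  runs c s T Q -> T <= T' ->
  (forall s', Q s' -> (forall x, x \notin assigned c -> s' x = s x) -> Q' s') ->
  runs c s T' Q'.
Proof.
move=> [t [s' [h1 h2 h3]]] le hQ; exists t, s'; split=> //.
  exact: leq_trans h2 le.
by apply: hQ => // x; apply: exec_frame h1.
Qed.

Lemma runs_le c s T T' Q : runs c s T Q -> T <= T' -> runs c s T' Q.
Proof. by move=> h le; apply: runs_conseq h le _. Qed.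

Lemma runs_assign x e s (Q : store -> Prop) :
  Q (upd s x (eval s e)) -> runs (Assign x e) s (expr_cost e).+1 Q.
Proof. by move=> h; exists (expr_cost e).+1, (upd s x (eval s e)); split=> //; constructor. Qed.

Lemma runs_seq c1 c2 s T1 T2 Q :
  runs c1 s T1 (fun s1 => runs c2 s1 T2 Q) -> runs (Seq c1 c2) s (T1 + T2).+1 Q.
Proof.
move=> [t1 [s1 [h1 le1 [t2 [s2 [h2 le2 hQ]]]]]]; exists (t1 + t2).+1, s2; split=> //.
  exact: exec_seq h1 h2.
by rewrite ltnS leq_add.
Qed.

Lemma runs_if e c1 c2 s T1 T2 Q :
  (eval s e <> Leaf -> runs c1 s T1 Q) -> (eval s e = Leaf -> runs c2 s T2 Q) ->
  runs (If e c1 c2) s (expr_cost e + (T1 + T2)).+1 Q.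
Proof.
move=> h1 h2; case he : (eval s e) => [|u v].
  have [t [s' [hx le hQ]]] := h2 he.
  exists (expr_cost e + t).+1, s'; split=> //; first exact: exec_if_false.
  by rewrite ltnS leq_add2l (leq_trans le) ?leq_addl.
have hn : eval s e <> Leaf by rewrite he.
have [t [s' [hx le hQ]]] := h1 hn.
exists (expr_cost e + t).+1, s'; split=> //; first exact: exec_if_true.
by rewrite ltnS leq_add2l (leq_trans le) ?leq_addr.
Qed.

Definition For (x l : nat) (body : cmd) : cmd :=
  While (Var l) (Seq (Assign x (Hd (Var l))) (Seq (Assign l (Tl (Var l))) body)).

(** The invariant sees the elements still to be processed. The overhead [10] pays for the test, two
    assignments and sequencing, the final [2] for the failing test. *)
Lemma runs_for_rem (E St : Type) (enc : E -> tree) (Rel : seq E -> St -> store -> Prop)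
    (step : St -> E -> St) x l body T (xs : seq E) a s :
  x != l -> l \notin assigned body -> s l = enc_seq (map enc xs) ->
  (forall a h xs s r, Rel (h :: xs) a s ->
     runs body (upd (upd s x (enc h)) l r) T (Rel xs (step a h))) ->
  Rel xs a s ->
  runs (For x l body) s (size xs * (T + 10) + 2) (Rel [::] (foldl step a xs)).
Proof.
move=> xl lb + hb; elim: xs a s => [|h xs IH] a s hs ha.
  by exists 2, s; split=> //; apply: exec_while_false.
have [t1 [s1 [h1 le1 hQ1]]] := hb a h xs s (enc_seq (map enc xs)) ha.
have hs1 : s1 l = enc_seq (map enc xs) by rewrite (exec_frame h1 lb) /upd eqxx.
have [t2 [s2 [h2 le2 hQ2]]] := IH _ _ hs1 hQ1.
exists (1 + (3 + (3 + t1).+1).+1 + t2).+1, s2; split=> //.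
  apply: exec_while_true h2; first by rewrite /= hs.
  apply: exec_seq; first exact: exec_assign.
  apply: exec_seq; first exact: exec_assign.
  suff -> : eval (upd s x (eval s (Hd (Var l)))) (Tl (Var l)) = enc_seq (map enc xs).
    by rewrite /= hs.
  by rewrite /= /upd eq_sym (negbTE xl) hs.
by rewrite [size _]/= mulSn; move: le1 le2; set u := size xs * _; lia.
Qed.

Lemma runs_for (E St : Type) (enc : E -> tree) (Rel : St -> store -> Prop)
    (step : St -> E -> St) x l body T (xs : seq E) a s :
  x != l -> l \notin assigned body -> s l = enc_seq (map enc xs) ->
  (forall a h s r, Rel a s ->
     runs body (upd (upd s x (enc h)) l r) T (Rel (step a h))) ->
  Rel a s -> runs (For x l body) s (size xs * (T + 10) + 2) (Rel (foldl step a xs)).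
Proof.
by move=> xl lb hs hb; apply: (runs_for_rem (enc := enc) (Rel := fun _ => Rel)) => // b h _; apply: hb.
Qed.

(** * Running one program inside another *)

Fixpoint shift_expr (k : nat) (e : expr) : expr :=
  match e with
  | Var x => Var (k + x)
  | Nil => Nil
  | Cons e1 e2 => Cons (shift_expr k e1) (shift_expr k e2)
  | Hd e => Hd (shift_expr k e)
  | Tl e => Tl (shift_expr k e)
  end.

Fixpoint shift (k : nat) (c : cmd) : cmd :=
  match c with
  | Assign x e => Assign (k + x) (shift_expr k e)
  | Seq c1 c2 => Seq (shift k c1) (shift k c2)
  | If e c1 c2 => If (shift_expr k e) (shift k c1) (shift k c2)
  | While e c => While (shift_expr k e) (shift k c)
  end.

Fixpoint expr_bound (e : expr) : nat :=
  match e with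
  | Var x => x.+1
  | Nil => 0
  | Cons e1 e2 => maxn (expr_bound e1) (expr_bound e2)
  | Hd e | Tl e => expr_bound e
  end.

Fixpoint cmd_bound (c : cmd) : nat :=
  match c with
  | Assign x e => maxn x.+1 (expr_bound e)
  | Seq c1 c2 => maxn (cmd_bound c1) (cmd_bound c2)
  | If e c1 c2 => maxn (expr_bound e) (maxn (cmd_bound c1) (cmd_bound c2))
  | While e c => maxn (expr_bound e) (cmd_bound c)
  end.

Lemma shift_expr_cost k e : expr_cost (shift_expr k e) = expr_cost e.
Proof. by elim: e => //= [e1 -> e2 ->|e ->|e ->]. Qed.

Lemma eval_shift k V s s1 e : expr_bound e <= V ->
  (forall x, x < V -> s1 (k + x) = s x) -> eval s1 (shift_expr k e) = eval s e.
Proof.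
move=> + h; elim: e => //=.
- by move=> e1 IH1 e2 IH2; rewrite geq_max => /andP[/IH1 -> /IH2 ->].
- by move=> e IH /IH ->.
- by move=> e IH /IH ->.
Qed.

Lemma exec_shift k V c s t s' : exec c s t s' -> cmd_bound c <= V ->
  forall s1, (forall x, x < V -> s1 (k + x) = s x) ->
  exists2 s1', exec (shift k c) s1 t s1' & forall x, x < V -> s1' (k + x) = s' x.
Proof.
elim=> {c s t s'} /=.
- move=> x e s; rewrite geq_max => /andP[xV eV] s1 h.
  exists (upd s1 (k + x) (eval s1 (shift_expr k e))).
    by rewrite -(shift_expr_cost k); constructor.
  move=> y yV; rewrite /upd eqn_add2l (eval_shift eV h).
  by case: eqP => // _; apply: h.
- move=> c1 c2 s1 t1 s2 t2 s3 _ IH1 _ IH2; rewrite geq_max => /andP[b1 b2] u hu.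
  have [u1 h1 /(IH2 b2)[u2 h2 e2]] := IH1 b1 u hu.
  by exists u2 => //; apply: exec_seq h1 h2.
- move=> e c1 c2 s t s' he _ IH; rewrite !geq_max => /and3P[be b1 b2] u hu.
  have [u1 h1 e1] := IH b1 u hu; exists u1 => //.
  by rewrite -(shift_expr_cost k); apply: exec_if_true; rewrite ?(eval_shift be hu).
- move=> e c1 c2 s t s' he _ IH; rewrite !geq_max => /and3P[be b1 b2] u hu.
  have [u1 h1 e1] := IH b2 u hu; exists u1 => //.
  by rewrite -(shift_expr_cost k); apply: exec_if_false; rewrite ?(eval_shift be hu).
- move=> e c s he; rewrite geq_max => /andP[be b] u hu; exists u => //.
  by rewrite -(shift_expr_cost k); apply: exec_while_false; rewrite ?(eval_shift be hu).
- move=> e c s1 t1 s2 t2 s3 he _ IH1 _ IH2 b u hu.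
  have /andP[be b1] : (expr_bound e <= V) && (cmd_bound c <= V) by rewrite -geq_max.
  have [u1 h1 /(IH2 b)[u2 h2 e2]] := IH1 b1 u hu.
  exists u2 => //; rewrite -(shift_expr_cost k).
  by apply: exec_while_true h1 h2; rewrite ?(eval_shift be hu).
Qed.

Lemma assigned_shift k c x : x < k -> x \notin assigned (shift k c).
Proof.
move=> xk; elim: c => //= [y _|c1 h1 c2 h2|_ c1 h1 c2 h2].
- by rewrite inE; lia.
- by rewrite mem_cat negb_or h1.
- by rewrite mem_cat negb_or h1.
Qed.

(** [computes] starts from a store that is [Leaf] off the input, whereas [A] is called repeatedly;
    its variables are cleared before each call. *)
Definition reset (k V : nat) : cmd :=
  foldr (fun x c => Seq (Assign (k + x) Nil) c) (Assign k Nil) (iota 0 V).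

(* The variables from [k] on hold the store of [A]. *)
Definition call (k : nat) (A : cmd) (e : expr) : cmd :=
  Seq (reset k (cmd_bound A).+1) (Seq (Assign k e) (shift k A)).

Lemma runs_reset k V s :
  runs (reset k V) s (V * 3 + 2)
    (fun s' => (forall x, x < V -> s' (k + x) = Leaf) /\ forall x, x < k -> s' x = s x).
Proof.
suff h l u : runs (foldr (fun x c => Seq (Assign (k + x) Nil) c) (Assign k Nil) l)
    u (size l * 3 + 2)
    (fun s' => (forall x, x \in l \/ u (k + x) = Leaf -> s' (k + x) = Leaf) /\
       forall x, x < k -> s' x = u x).
  have := h (iota 0 V) s; rewrite size_iota => {}h; apply: runs_conseq h _ _ => //.
  by move=> s' [h1 h2] _; split=> // x xV; apply: h1; left; rewrite mem_iota xV.
elim: l u => [|a l IH] u /=.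
  apply: runs_assign; rewrite /upd; split=> x /=.
    by case: eqP => // _ [].
  by case: eqP => // -> ; rewrite ltnn.
apply: runs_le; first (apply: runs_seq; apply: runs_assign).
  apply: runs_conseq (IH _) (leqnn _) _ => s' [h1 h2] _; split=> x.
    rewrite inE => hx; apply: h1; rewrite /upd eqn_add2l.
    by move: hx; case: eqP => /= [_ _|_ hx]; [right | exact: hx].
  by move=> xk; rewrite h2 // /upd; case: eqP => //; lia.
by rewrite /=; lia.
Qed.

Lemma runs_call k A e inp out t T s :
  computes A inp t out -> t <= T ->
  (forall s', (forall x, x < k -> s' x = s x) -> eval s' e = inp) ->
  runs (call k A e) s ((cmd_bound A).+1 * 3 + expr_cost e + T + 5)
    (fun s' => s' k = out /\ forall x, x < k -> s' x = s x).
Proof.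
move=> [sA [hA outA]] tT he.
apply: runs_le; first (apply: runs_seq; apply: runs_conseq (runs_reset _ _ _) (leqnn _) _).
  move=> s1 [z1 f1] _; apply: runs_seq; apply: runs_assign.
  rewrite (he _ f1).
  have [|s2 h2 e2] := exec_shift (k := k) hA (leqnSn _) (s1 := upd s1 k inp).
    move=> x xV; have kx : (k + x == k) = (x == 0) by lia.
    rewrite /upd kx; case: eqP => // _. exact: z1.
  exists t, s2; split; [exact: h2 | exact: tT |].
  split=> [|x xk]; first by rewrite -outA -(e2 0) ?addn0.
  by rewrite (exec_frame h2) ?assigned_shift // /upd (ltn_eqF xk) f1.
by lia.
Qed.

Definition bit (t : tree) : bool := if t is Node _ _ then true else false.
Definition hd (t : tree) : tree := if t is Node l _ then l else Leaf.
Definition tl (t : tree) : tree := if t is Node _ r then r else Leaf.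

Definition dec_option_bool (t : tree) : option bool :=
  if t is Node _ r then Some (bit r) else None.

Lemma hd_iter_tl ts i : hd (iter i tl (enc_seq ts)) = nth Leaf ts i.
Proof. by elim: i ts => [|i IH] [|t ts] //; rewrite iterSr /= ?IH // (IH [::]) nth_nil. Qed.

Lemma eval_iter_tl s j e : eval s (iter j Tl e) = iter j tl (eval s e).
Proof. by elim: j => //= j ->. Qed.

Lemma cost_iter_tl j e : expr_cost (iter j Tl e) = j + expr_cost e.
Proof. by elim: j => //= j ->. Qed.

Lemma eval_iter_cons s j e :
  eval s (iter j (Cons Nil) e) = iter j (Node Leaf) (eval s e).
Proof. by elim: j => //= j ->. Qed.

Lemma cost_iter_cons j e : expr_cost (iter j (Cons Nil) e) = j * 2 + expr_cost e.
Proof. by elim: j => //= j ->; lia. Qed.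

Lemma iter_cons_enc_nat i j : iter i (Node Leaf) (enc_nat j) = enc_nat (i + j).
Proof. by elim: i => //= i ->. Qed.

Lemma iter_tl_enc_nat i j : iter i tl (enc_nat j) = enc_nat (j - i).
Proof. by elim: i j => [|i IH] [|j] //; rewrite iterSr /= ?(IH 0) ?IH. Qed.

Lemma enc_natP j : reflect (enc_nat j = Leaf) (j == 0).
Proof. by case: j => [|j]; constructor. Qed.

(** * Restricting a formula by a partial assignment *)

(** The language has no empty command; variable 24 is a dummy. *)
Definition skip : cmd := Assign 24 Nil.

(* Walks the list in variable 23 down to the variable index of the literal in
   variable 11; the result is left in variable 14. *)
Definition lookup : cmd :=
  Seq (Assign 14 (Var 23))
    (Seq (Assign 12 (Hd (Var 11))) (For 13 12 (Assign 14 (Tl (Var 14))))).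

Lemma runs_lookup n (l : literal n) s : s 11 = enc_literal l ->
  runs lookup s (13 * n + 9) (fun s' => s' 14 = iter l.1 tl (s 23)).
Proof.
move=> hl; apply: runs_le.
  apply: runs_seq; apply: runs_assign; apply: runs_seq; apply: runs_assign.
  apply: runs_conseq (runs_for (E := tree) (enc := id) (step := fun t _ => tl t)
    (Rel := fun t s => s 14 = t) (xs := nseq l.1 Leaf) (a := s 23) (T := 3) _ _ _ _ _) _ _ => //.
  - by rewrite map_id /upd /= hl.
  - by move=> a h u r hu; apply: runs_assign; rewrite /upd /= hu.
  - move=> s' -> _; elim: (val l.1) (s 23) => //= j IH t.
    by rewrite IH -iterS iterSr.
by rewrite size_nseq /=; have := ltn_ord l.1; lia.
Qed.

(** Variable 16 collects unassigned literals, variable 17 records whether some literal is already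
    true. [ent] is a parameter because guesses are stored as optional bits and the output of [A] as
    plain bits. *)
Definition restrict_lit (ent : expr) : cmd :=
  Seq lookup (Seq (Assign 15 ent)
    (If (Var 15)
       (If (Tl (Var 15))
          (If (Tl (Var 11)) (Assign 17 (Cons Nil Nil)) skip)
          (If (Tl (Var 11)) skip (Assign 17 (Cons Nil Nil))))
       (Assign 16 (Cons (Var 11) (Var 16))))).

(* Restricts the list of clauses in variable 8 by the partial assignment that
   [ent] reads off the list in variable 23; the result is left in variable 18. *)
Definition restrict_cmd (ent : expr) : cmd :=
  Seq (Assign 18 Nil)
    (For 9 8
       (Seq (Assign 16 Nil) (Seq (Assign 17 Nil) (Seq (Assign 10 (Var 9))
         (Seq (For 11 10 (restrict_lit ent))
           (If (Var 17) skip (Assign 18 (Cons (Var 16) (Var 18))))))))).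

(** Here and in [restrict], the reversal matches the order in which the program accumulates its
    results. *)
Lemma size_restrict_clause n (sigma : 'I_n -> option bool) (c : clause n) :
  size (rev [seq l : literal n <- c | sigma l.1 == None]) <= 3.
Proof. by rewrite size_rev size_filter (leq_trans (count_size _ _)) ?size_bseq. Qed.

Definition restrict_clause n (sigma : 'I_n -> option bool) (c : clause n) : clause n :=
  Bseq (size_restrict_clause sigma c).

Definition forced n (sigma : 'I_n -> option bool) (c : clause n) : bool :=
  has (fun l : literal n => sigma l.1 == Some l.2) c.

Definition restrict n (sigma : 'I_n -> option bool) (phi : cnf3 n) : cnf3 n :=
  rev [seq restrict_clause sigma c | c <- phi & ~~ forced sigma c].

Section RunsRestrict.
Variables (n : nat) (sigma : 'I_n -> option bool) (tab : tree) (ent : expr).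
Hypothesis ent_le : expr_cost ent <= 10.
(** Only the decoded value is prescribed, as the output of [A] may be any tree. *)
Hypothesis entP : forall (i : 'I_n) s, s 14 = iter i tl tab ->
  dec_option_bool (eval s ent) = sigma i.

Let Rlit (a : seq (literal n) * bool) (s : store) : Prop :=
  [/\ s 16 = enc_seq (map (@enc_literal n) a.1), s 17 = enc_bool a.2 & s 23 = tab].

Let step (a : seq (literal n) * bool) (l : literal n) :=
  if sigma l.1 is Some b then (a.1, (b == l.2) || a.2) else (l :: a.1, a.2).

Lemma runs_restrict_lit a l s : Rlit a s -> s 11 = enc_literal l ->
  runs (restrict_lit ent) s (13 * n + 60) (Rlit (step a l)).
Proof.
move=> [h16 h17 h23] hl; apply: runs_le.
  apply: runs_seq; apply: runs_conseq (runs_lookup hl) (leqnn _) _ => s1 h14 f1.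
  apply: runs_seq; apply: runs_assign.
  rewrite h23 in h14; have {h14} := entP h14.
  have g16 : s1 16 = enc_seq (map (@enc_literal n) a.1) by rewrite f1.
  have g17 : s1 17 = enc_bool a.2 by rewrite f1.
  have g23 : s1 23 = tab by rewrite f1.
  have g11 : s1 11 = enc_literal l by rewrite f1.
  rewrite /Rlit /step; case he: (eval s1 ent) => [|u v] /= <-.
    apply: runs_if; first by rewrite /upd /=.
    by move=> _; apply: runs_assign; rewrite /upd /= g16 g17 g11.
  apply: runs_if; last by rewrite /upd /=.
  move=> _; apply: runs_if.
    rewrite /upd /= => hv; apply: runs_if; rewrite /= g11 /=; case: (l.2) => //= _;
    by apply: runs_assign; rewrite /upd /= ?g16 ?g17; split=> //; case: (v) hv.
  rewrite /upd /= => hv; apply: runs_if; rewrite /= g11 /=; case: (l.2) => //= _;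
  by apply: runs_assign; rewrite /upd /= ?g16 ?g17; split=> //; rewrite hv.
by rewrite /=; lia.
Qed.

Lemma foldl_step (ls : seq (literal n)) a :
  foldl step a ls =
    (catrev [seq l <- ls | sigma l.1 == None] a.1,
     has (fun l => sigma l.1 == Some l.2) ls || a.2).
Proof.
elim: ls a => [|l ls IH] [c f] //=; rewrite {}IH /step.
by case: (sigma l.1) => [b|] //=; rewrite orbA [_ || (b == _)]orbC.
Qed.

Let Rcl (acc : seq (clause n)) (s : store) : Prop :=
  s 18 = enc_seq (map (@enc_clause n) acc) /\ s 23 = tab.

Lemma runs_restrict_cmd (phi : cnf3 n) s :
  s 8 = enc_seq (map (@enc_clause n) phi) -> s 23 = tab ->
  runs (restrict_cmd ent) s (size phi * (39 * n + 260) + 10)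
    (fun s' => s' 18 = enc_seq (map (@enc_clause n) (restrict sigma phi))).
Proof.
move=> h8 h23; apply: runs_le.
  apply: runs_seq; apply: runs_assign.
  pose cstep (acc : cnf3 n) (c : clause n) :=
    if forced sigma c then acc else restrict_clause sigma c :: acc.
  apply: runs_conseq (runs_for (enc := @enc_clause n) (step := cstep)
    (Rel := Rcl) (xs := phi) (a := [::]) (T := 39 * n + 250) _ _ _ _ _) (leqnn _) _ => //.
  - move=> acc c u r [g18 g23]; apply: runs_le.
      apply: runs_seq; apply: runs_assign; apply: runs_seq; apply: runs_assign.
      apply: runs_seq; apply: runs_assign; apply: runs_seq.
      apply: runs_conseq (runs_for (enc := @enc_literal n) (step := step)
        (Rel := Rlit) (xs := c) (a := ([::], false)) (T := 13 * n + 60) _ _ _ _ _)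
        (leqnn _) _ => //.
      + by move=> a l v t ra; apply: runs_restrict_lit.
      + move=> s1 [] + + k23 f1; rewrite foldl_step orbF /= => k16 k17.
        have {}k16 : s1 16 = enc_clause (restrict_clause sigma c).
          by rewrite k16 /enc_clause.
        have k18 : s1 18 = enc_seq (map (@enc_clause n) acc) by rewrite f1.
        rewrite /Rcl /cstep /forced.
        case: (has _ _) k17 => /= k17.
          apply: runs_if; last by rewrite /= k17.
          by move=> _; apply: runs_assign; rewrite /upd /=.
        apply: runs_if; first by rewrite /= k17.
        by move=> _; apply: runs_assign; rewrite /upd /= k16 k18.
    by rewrite /=; have := size_bseq c; nia.
  - move=> s' [h18 _] _; rewrite h18; congr (enc_seq (map _ _)).
    rewrite /restrict -(cats0 (rev _)) -catrevE.
    elim: phi {h8 h18} [::] => //= c phi IH acc; rewrite {}IH /cstep.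
    by case: (forced sigma c).
by rewrite /=; nia.
Qed.
End RunsRestrict.

(** * Enumerating partial assignments *)

(* A guessed [tau], an advice, and a remaining budget; [expand] charges [q + 1]
   units of the budget for each index where one of the two is defined. *)
Definition entry : Type := (seq (option bool) * seq (option bool) * nat)%type.

Definition enc_entry (e : entry) : tree :=
  Node (enc_seq (map enc_option_bool e.1.1))
    (Node (enc_seq (map enc_option_bool e.1.2)) (enc_nat e.2)).

Definition options : seq (option bool * option bool) :=
  [seq (x, y) | x <- [:: None; Some true; Some false],
                y <- [:: None; Some true; Some false]].

Definition grow (e : entry) (b : nat) (o : option bool * option bool) : entry :=
  (o.1 :: e.1.1, o.2 :: e.1.2, b).

Definition expand (q : nat) (e : entry) : seq entry :=
  grow e e.2 (None, None) ::
    if q < e.2 then [seq grow e (e.2 - q.+1) o | o <- options] else [::].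

Definition expand_all (q : nat) (L : seq entry) : seq entry :=
  rev (flatten (map (expand q) L)).

Fixpoint quote (t : tree) : expr :=
  if t is Node l r then Cons (quote l) (quote r) else Nil.

Lemma eval_quote s t : eval s (quote t) = t.
Proof. by elim: t => //= l -> r ->. Qed.

Lemma cost_quote_option o : expr_cost (quote (enc_option_bool o)) <= 5.
Proof. by case: o => [[]|]. Qed.

Definition grow_cmd (b : expr) (o : option bool * option bool) : cmd :=
  Assign 4 (Cons (Cons (Cons (quote (enc_option_bool o.1)) (Hd (Var 5)))
    (Cons (Cons (quote (enc_option_bool o.2)) (Hd (Tl (Var 5)))) b)) (Var 4)).

(** In unary, [q < e.2] is tested by removing [q] units and checking that something is left. *)
Definition expand_cmd (q : nat) : cmd :=
  Seq (grow_cmd (Tl (Tl (Var 5))) (None, None))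
    (If (iter q Tl (Tl (Tl (Var 5))))
      (foldr (fun o => Seq (grow_cmd (iter q.+1 Tl (Tl (Tl (Var 5)))) o)) skip options)
      skip).

Lemma runs_grow_cmd e b bud o acc s : s 5 = enc_entry e -> eval s bud = enc_nat b ->
  s 4 = enc_seq (map enc_entry acc) ->
  runs (grow_cmd bud o) s (expr_cost bud + 30)
    (fun s' => s' 4 = enc_seq (map enc_entry (grow e b o :: acc))).
Proof.
move=> h5 hb h4; apply: runs_le; first apply: runs_assign.
  by rewrite /upd /= !eval_quote h5 hb h4.
rewrite /=; have := cost_quote_option o.1; have := cost_quote_option o.2; lia.
Qed.

Lemma runs_grow_all e q os acc s : s 5 = enc_entry e ->
  s 4 = enc_seq (map enc_entry acc) ->
  runs (foldr (fun o => Seq (grow_cmd (iter q.+1 Tl (Tl (Tl (Var 5)))) o)) skip os) s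
    (size os * (q + 50) + 5)
    (fun s' => s' 4 =
       enc_seq (map enc_entry (catrev [seq grow e (e.2 - q.+1) o | o <- os] acc))).
Proof.
elim: os acc s => [|o os IH] acc s h5 h4.
  by apply: runs_le; first (apply: runs_assign; rewrite /upd /=).
apply: runs_le.
  apply: runs_seq; apply: runs_conseq (leqnn _) _.
    apply: (@runs_grow_cmd e (e.2 - q.+1) _ o acc) => //.
    by rewrite eval_iter_tl /= h5 -iterS iter_tl_enc_nat.
  by move=> s1 g4 f1; apply: IH => //; rewrite f1.
by rewrite cost_iter_tl /=; lia.
Qed.

Lemma runs_expand_cmd q e acc s : s 5 = enc_entry e ->
  s 4 = enc_seq (map enc_entry acc) ->
  runs (expand_cmd q) s (20 * (q + 50))
    (fun s' => s' 4 = enc_seq (map enc_entry (catrev (expand q e) acc))).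
Proof.
move=> h5 h4; apply: runs_le.
  apply: runs_seq; apply: runs_conseq (leqnn _) _.
    by apply: (@runs_grow_cmd e e.2 _ _ acc) => //=; rewrite h5.
  move=> s1 g4 f1.
  have he : eval s1 (iter q Tl (Tl (Tl (Var 5)))) = enc_nat (e.2 - q).
    by rewrite eval_iter_tl /= f1 // h5 iter_tl_enc_nat.
  apply: runs_if; rewrite he => /enc_natP.
    rewrite subn_eq0 -ltnNge => qe.
    apply: runs_conseq (leqnn _) _; first by apply: (@runs_grow_all e q options _ s1 _ g4); rewrite f1.
    by move=> s2 -> _; rewrite /expand qe.
  rewrite subn_eq0 leqNgt => /negbTE qe; apply: runs_assign.
  by rewrite /upd /= g4 qe.
by rewrite cost_iter_tl /=; lia.
Qed.

Lemma foldl_catrev (S T : Type) (f : S -> seq T) xs acc :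
  foldl (fun acc x => catrev (f x) acc) acc xs = rev (flatten (map f xs)) ++ acc.
Proof. by elim: xs acc => //= x xs IH acc; rewrite IH catrevE rev_cat catA. Qed.

Definition expand_all_cmd (q : nat) : cmd :=
  Seq (Assign 4 Nil) (Seq (For 5 3 (expand_cmd q)) (Assign 3 (Var 4))).

Lemma runs_expand_all_cmd q L s : s 3 = enc_seq (map enc_entry L) ->
  runs (expand_all_cmd q) s (size L * (20 * (q + 50) + 10) + 10)
    (fun s' => s' 3 = enc_seq (map enc_entry (expand_all q L))).
Proof.
move=> h3; apply: runs_le.
  apply: runs_seq; apply: runs_assign; apply: runs_seq.
  apply: runs_conseq (runs_for (enc := enc_entry)
    (step := fun acc e => catrev (expand q e) acc)
    (Rel := fun acc s => s 4 = enc_seq (map enc_entry acc)) (xs := L) (a := [::])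
    (T := 20 * (q + 50)) _ _ _ _ _) (leqnn _) _ => //.
    by move=> a e u r hu; apply: runs_expand_cmd.
  move=> s1 h4 _; apply: runs_assign; rewrite /upd /= h4; congr (enc_seq (map _ _)).
  by rewrite foldl_catrev cats0.
by rewrite /=; lia.
Qed.

(** Each entry has at least its free child [(None, None)], so lists never shrink and the last one
    bounds the cost of every round. *)
Lemma size_expand_all q L : size L <= size (expand_all q L).
Proof.
rewrite size_rev size_flatten /shape -map_comp.
by elim: L => //= e L IH; rewrite addSn ltnS (leq_trans IH) ?leq_addl.
Qed.

Lemma size_iter_expand_all q j L : size L <= size (iter j (expand_all q) L).
Proof. by elim: j => //= j IH; apply: leq_trans IH (size_expand_all _ _). Qed.

Definition enumerate_cmd (q : nat) : cmd :=
  Seq (Assign 7 (Var 1)) (For 6 7 (expand_all_cmd q)).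

Lemma runs_enumerate_cmd q n L s : s 1 = enc_nat n ->
  s 3 = enc_seq (map enc_entry L) ->
  runs (enumerate_cmd q) s
    (n * (size (iter n (expand_all q) L) * (20 * (q + 50) + 10) + 20) + 10)
    (fun s' => s' 3 = enc_seq (map enc_entry (iter n (expand_all q) L))).
Proof.
move=> h1 h3; set M := size _.
apply: runs_le.
  apply: runs_seq; apply: runs_assign.
  (* The remaining rounds lead from the current list to the final one, so [M] also bounds the
     current size. *)
  apply: runs_conseq (runs_for_rem (E := tree) (enc := id)
    (step := fun L _ => expand_all q L)
    (Rel := fun xs L s => s 3 = enc_seq (map enc_entry L) /\
        size (iter (size xs) (expand_all q) L) <= M) (xs := nseq n Leaf) (a := L)
    (T := M * (20 * (q + 50) + 10) + 10) _ _ _ _ _) (leqnn _) _ => //.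
  - by rewrite map_id /upd /= h1.
  - move=> L' h xs u r [g3 gM]; apply: runs_conseq.
    + by apply: runs_expand_all_cmd; exact: g3.
    + rewrite leq_add2r leq_mul2r; apply/orP; right.
      exact: leq_trans (size_iter_expand_all q _ _) gM.
    + by move=> s' ? _; split=> //; move: gM; rewrite /= -iterS iterSr.
  - by split; rewrite ?size_nseq // /upd /= h3.
  move=> s' [-> _] _; congr (enc_seq (map _ _)).
  by elim: n {h1 M} L {h3} => //= n IH L; rewrite IH -iterS iterSr.
by rewrite size_nseq /=; lia.
Qed.

(** * The search program *)

(* Variables: 1 number of variables, 2 clauses, 3 list of entries, 5 current
   entry, 21 answer, 22 restricted formula, 25 input and output of [A].  The
   final comparison [D u <= P m] leaves [1 + P m - D u], truncated, in unary in
   variable 19. *)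
Definition try_cmd (A : cmd) (P D : nat) : cmd :=
  Seq (Assign 23 (Hd (Var 5))) (Seq (Assign 8 (Var 2))
  (Seq (restrict_cmd (Hd (Var 14))) (Seq (Assign 22 (Var 18))
  (Seq (call 25 A (Cons (Cons (Var 1) (Var 22)) (Hd (Tl (Var 5)))))
  (Seq (Assign 23 (Var 25)) (Seq (Assign 8 (Var 22))
  (Seq (restrict_cmd (Cons Nil (Hd (Var 14))))
  (Seq (Assign 19 (Cons Nil Nil)) (Seq (Assign 8 (Var 2))
  (Seq (For 9 8 (Assign 19 (iter P (Cons Nil) (Var 19))))
  (Seq (Assign 8 (Var 18)) (Seq (For 9 8 (Assign 19 (iter D Tl (Var 19))))
  (If (Var 19) (Assign 21 (Cons Nil Nil)) skip))))))))))))).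

(** The initial budget [C + n] allows at most [(C + n) / (q + 1)] indices to carry a value. *)
Definition search_cmd (A : cmd) (q C P D : nat) : cmd :=
  Seq (Assign 1 (Hd (Var 0))) (Seq (Assign 2 (Tl (Var 0)))
  (Seq (Assign 3 (Cons (Cons Nil (Cons Nil (iter C (Cons Nil) (Var 1)))) Nil))
  (Seq (enumerate_cmd q) (Seq (Assign 21 Nil)
  (Seq (For 5 3 (try_cmd A P D)) (Assign 0 (Var 21))))))).

Lemma assigned_reset k V x : x < k -> x \notin assigned (reset k V).
Proof.
move=> xk; rewrite /reset; elim: (iota _ _) => [|y l IH] /=.
  by rewrite inE (ltn_eqF xk).
by rewrite inE negb_or IH andbT; lia.
Qed.

Lemma assigned_call k A e x : x < k -> x \notin assigned (call k A e).
Proof.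
move=> xk; rewrite /call; move: (reset _ _) (assigned_reset (cmd_bound A).+1 xk) => c hc.
by rewrite /= mem_cat in_cons !negb_or hc assigned_shift // andbT (ltn_eqF xk).
Qed.

Definition partial n (ts : seq (option bool)) : advice n :=
  [ffun i : 'I_n => nth None ts i].

(** Total on all trees, so whatever [A] outputs is read as an assignment. *)
Definition read_bits n (t : tree) : assignment n :=
  [ffun i : 'I_n => bit (hd (iter i tl t))].

Lemma dec_enc_option_bool o : dec_option_bool (enc_option_bool o) = o.
Proof. by case: o => [[]|]. Qed.

Lemma partialK n ts : size ts = n -> [seq partial n ts i | i <- enum 'I_n] = ts.
Proof.
move=> <-; rewrite -[RHS](mkseq_nth None) /mkseq -val_enum_ord -map_comp.
by apply: eq_map => i; rewrite /= ffunE.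
Qed.

Section Search.
Variables (A : cmd) (P D n : nat) (phi : cnf3 n).
Variable (out : cnf3 n * advice n -> tree).
Variable T : nat.
Hypothesis outP : forall psi w, size psi <= size phi ->
  exists2 t, computes A (enc_input psi w) t (out (psi, w)) & t <= T.

(** Restricting [psi] by the total assignment [b] deletes exactly the satisfied clauses, so the size
    on the left counts the falsified ones. *)
Definition accepts (e : entry) : bool :=
  let psi := restrict (partial n e.1.1) phi in
  let b := read_bits n (out (psi, partial n e.1.2)) in
  D * size (restrict (fun i => Some (b i)) psi) <= P * size phi.

Definition try_time : nat :=
  size phi * (78 * n + 3 * P + D + 600) + (cmd_bound A * 3 + T + 300).

Let R (r : bool) (s : store) : Prop :=
  [/\ s 1 = enc_nat n, s 2 = enc_seq (map (@enc_clause n) phi) & s 21 = enc_bool r].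

Lemma runs_try_cmd e r s : R r s -> s 5 = enc_entry e -> size e.1.2 = n ->
  runs (try_cmd A P D) s try_time (R (r || accepts e)).
Proof.
move=> [h1 h2 h21] h5 he.
set psi := restrict (partial n e.1.1) phi.
have psi_le : size psi <= size phi.
  by rewrite size_rev size_map size_filter count_size.
have [t At tT] := outP (partial n e.1.2) psi_le.
set o := out _ in At; set b := read_bits n o.
set chi := restrict (fun i => Some (b i)) psi.
have chi_le : size chi <= size phi.
  by rewrite (leq_trans _ psi_le) // size_rev size_map size_filter count_size.
apply: runs_le.
  do 2 (apply: runs_seq; apply: runs_assign).
  apply: runs_seq; apply: runs_conseq (leqnn _) _.
    apply: (@runs_restrict_cmd n (partial n e.1.1) (enc_seq (map enc_option_bool e.1.1)) _ _ _ phi).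
    - by [].
    - move=> i u hu; rewrite /= hu.
      transitivity (dec_option_bool (nth Leaf (map enc_option_bool e.1.1) i)).
        by rewrite -hd_iter_tl; case: (iter _ _ _).
      rewrite ffunE; case: (ltnP i (size e.1.1)) => hi.
        by rewrite (nth_map None) // dec_enc_option_bool.
      by rewrite !nth_default ?size_map.
    - by rewrite /upd /= h2.
    - by rewrite /upd /= h5.
  rewrite -/psi => s1 h18 f1.
  apply: runs_seq; apply: runs_assign.
  have g1 : s1 1 = enc_nat n by rewrite f1.
  have g2 : s1 2 = enc_seq (map (@enc_clause n) phi) by rewrite f1.
  have g5 : s1 5 = enc_entry e by rewrite f1.
  have g21 : s1 21 = enc_bool r by rewrite f1.
  apply: runs_seq; apply: runs_conseq (leqnn _) _.
    apply: (runs_call At tT) => u hu.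
    rewrite /= !hu // /upd /= g1 g5 h18 /enc_input /enc_cnf /=; congr (Node _ (enc_seq _)).
    (* Length [n] makes the stored list literally the encoding of an advice. *)
    by rewrite -[in LHS](partialK he) -map_comp.
  move=> s2 [k25 f2] _.
  have k1 : s2 1 = enc_nat n by rewrite f2.
  have k2 : s2 2 = enc_seq (map (@enc_clause n) phi) by rewrite f2.
  have k21 : s2 21 = enc_bool r by rewrite f2.
  have k22 : s2 22 = enc_seq (map (@enc_clause n) psi) by rewrite f2 // /upd /= h18.
  do 2 (apply: runs_seq; apply: runs_assign).
  apply: runs_seq; apply: runs_conseq (leqnn _) _.
    apply: (@runs_restrict_cmd n (fun i => Some (b i)) o _ _ _ psi).
    - by [].
    - by move=> i u hu; rewrite /= hu /b ffunE; case: (iter _ _ _).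
    - by rewrite /upd /= k22.
    - by rewrite /upd /= k25.
  rewrite -/chi => s3 i18 f3.
  have i1 : s3 1 = enc_nat n by rewrite f3.
  have i2 : s3 2 = enc_seq (map (@enc_clause n) phi) by rewrite f3.
  have i21 : s3 21 = enc_bool r by rewrite f3.
  do 2 (apply: runs_seq; apply: runs_assign).
  apply: runs_seq; apply: runs_conseq (leqnn _) _.
    apply: (runs_for (enc := @enc_clause n) (step := fun a _ => P + a)
      (Rel := fun a s => s 19 = enc_nat a) (xs := phi) (a := 1)
      (T := P * 2 + 2)) => //.
    move=> a c u z ha; apply: runs_le; first apply: runs_assign.
      by rewrite eval_iter_cons /upd /= ha iter_cons_enc_nat.
    by rewrite cost_iter_cons /=; lia.
  move=> s4 j19 f4.
  apply: runs_seq; apply: runs_assign.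
  apply: runs_seq; apply: runs_conseq (leqnn _) _.
    apply: (runs_for (enc := @enc_clause n) (step := fun a _ => a - D)
      (Rel := fun a s => s 19 = enc_nat a) (xs := chi)
      (a := foldl (fun a _ => P + a) 1 phi) (T := D + 2)) => //.
      by rewrite /upd /= f4 // i18.
    move=> a c u z ha; apply: runs_le; first apply: runs_assign.
      by rewrite eval_iter_tl /upd /= ha iter_tl_enc_nat.
    by rewrite cost_iter_tl /=; lia.
  move=> s5 l19 f5.
  have l1 : s5 1 = enc_nat n by rewrite f5 // /upd /= f4.
  have l2 : s5 2 = enc_seq (map (@enc_clause n) phi) by rewrite f5 // /upd /= f4.
  have l21 : s5 21 = enc_bool r by rewrite f5 // /upd /= f4.
  have EP a (xs : cnf3 n) : foldl (fun a _ => P + a) a xs = P * size xs + a.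
    by elim: xs a => [|x xs IH] a /=; rewrite ?IH ?muln0 // mulnS; lia.
  have ED a (xs : cnf3 n) : foldl (fun a _ => a - D) a xs = a - D * size xs.
    by elim: xs a => [|x xs IH] a /=; rewrite ?IH ?muln0 ?subn0 // mulnS; lia.
  have lP : eval s5 (Var 19) = Leaf <-> ~~ accepts e.
    rewrite /= l19 EP ED /accepts -/psi -/b -/chi.
    by split=> [/enc_natP|h]; [| apply/enc_natP]; lia.
  apply: runs_if => hv; apply: runs_assign; rewrite /R /upd /=.
    have -> : accepts e by apply/negPn/negP => /lP.
    by rewrite orbT.
  by move/lP: hv => /negbTE ->; rewrite orbF.
by rewrite /try_time /=; nia.
Qed.

Definition entries (q C : nat) : seq entry :=
  iter n (expand_all q) [:: ([::], [::], C + n)].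

Lemma assigned_try_cmd : 3 \notin assigned (try_cmd A P D).
Proof.
rewrite /try_cmd; move: (call _ _ _) (assigned_call A (Cons (Cons (Var 1) (Var 22))
  (Hd (Tl (Var 5)))) (isT : 3 < 25)) => c hc.
by rewrite /= !(inE, mem_cat) /= (negbTE hc).
Qed.

Lemma runs_search_cmd q C :
  runs (search_cmd A q C P D) (upd (fun=> Leaf) 0 (enc_cnf phi))
    (size (entries q C) * (n * (20 * (q + 50) + 10) + try_time + 10) + n * 20 + C * 2 + 100)
    (fun s => s 0 = enc_bool (has accepts (entries q C))).
Proof.
apply: runs_le.
  do 3 (apply: runs_seq; apply: runs_assign).
  apply: runs_seq; apply: runs_conseq (leqnn _) _.
    apply: (@runs_enumerate_cmd q n [:: ([::], [::], C + n)]); rewrite /upd //=.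
    by rewrite eval_iter_cons /= iter_cons_enc_nat.
  rewrite -/(entries q C) => s1 h3 f1.
  apply: runs_seq; apply: runs_assign; apply: runs_seq.
  apply: runs_conseq (runs_for_rem (enc := enc_entry)
    (step := fun r e => r || accepts e)
    (Rel := fun xs r s => R r s /\ all (fun e => size e.1.2 == n) xs)
    (xs := entries q C) (a := false) (T := try_time) _ _ _ _ _) (leqnn _) _ => //.
  - exact: assigned_try_cmd.
  - move=> r e xs u z [[g1 g2 g21] /= /andP[/eqP he hxs]].
    apply: runs_conseq; first by apply: (runs_try_cmd (e := e) (r := r)).
      by [].
    by move=> u' ? _.
  - split; first by split; rewrite /upd /= ?f1.
    (* Each round adds one element to the advice, so its length plus the number [j] of remaining
       rounds stays [n]. *)
    rewrite /entries; suff h j L : all (fun e : entry => size e.1.2 + j == n) L ->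
        all (fun e : entry => size e.1.2 == n) (iter j (expand_all q) L).
      by apply: h => /=; rewrite eqxx.
    elim: j L => [|j IH] L; first by apply: sub_all => e; rewrite addn0.
    rewrite iterSr => hL; apply: IH; rewrite all_rev; elim: L hL => //= e L IHL.
    move=> /andP[he /IHL hL]; rewrite addSnnS he all_cat hL andbT.
    by case: ifP => //= _; rewrite addSnnS he.
  - move=> s2 [[_ _ h21] _] _; apply: runs_assign; rewrite /upd /= h21.
    congr enc_bool; rewrite -[RHS]orFb.
    by elim: (entries q C) false => [|e L IH] r; rewrite /= ?orbF // IH orbA.
rewrite -/(entries q C) /= cost_iter_cons /=; nia.
Qed.
End Search.

(** * Semantics of restriction *)

Lemma size_restrict n (sigma : 'I_n -> option bool) phi :
  size (restrict sigma phi) = count (fun c => ~~ forced sigma c) phi.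
Proof. by rewrite size_rev size_map size_filter. Qed.

Definition patch n (sigma : 'I_n -> option bool) (b : assignment n) : assignment n :=
  [ffun i => odflt (b i) (sigma i)].

Lemma clause_sat_patch n (sigma : 'I_n -> option bool) (b : assignment n) c :
  clause_sat (patch sigma b) c = forced sigma c || clause_sat b (restrict_clause sigma c).
Proof.
rewrite /clause_sat /forced /= has_rev.
elim: (c : seq _) => //= l ls IH; rewrite {}IH ffunE.
by case: (sigma l.1) => [v|] //=; rewrite -?orbA // orbCA.
Qed.

(** Forced clauses are satisfied after patching; any other clause is satisfied by [patch sigma b]
    exactly when its restriction is by [b]. Losses thus transfer exactly. *)
Lemma count_restrict n (sigma : 'I_n -> option bool) (b : assignment n) phi :
  count (fun c => ~~ clause_sat b c) (restrict sigma phi) =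
  count (fun c => ~~ clause_sat (patch sigma b) c) phi.
Proof.
rewrite /restrict count_rev count_map count_filter; apply: eq_count => c /=.
by rewrite clause_sat_patch negb_or andbC.
Qed.

(** Patching [a] with its own values changes nothing, so [count_restrict] leaves no falsified
    clause. *)
Lemma satisfies_restrict n (sigma : 'I_n -> option bool) (a : assignment n) phi :
  (forall i v, sigma i = Some v -> v = a i) ->
  all (clause_sat a) phi -> all (clause_sat a) (restrict sigma phi).
Proof.
move=> ha; rewrite !all_count => /eqP h.
have hp : patch sigma a = a.
  by apply/ffunP => i; rewrite ffunE; case hs : (sigma i) => [v|] //=; apply: ha.
have e1 := count_predC (clause_sat a) (restrict sigma phi).
have e2 := count_predC (clause_sat a) phi.
have e3 : count (predC (clause_sat a)) (restrict sigma phi) =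
    count (predC (clause_sat a)) phi by have := count_restrict sigma a phi; rewrite hp.
by apply/eqP; lia.
Qed.

(** * Completeness of the search *)

Definition residue_block n (r j : nat) : {set 'I_n} := [set i : 'I_n | i %% r == j].

(** Inside a block an index is determined by its quotient by [r]; for [r = 0] a block has at most
    one element because [i %% 0 = i]. *)
Lemma card_residue_block n (r j : nat) : #|residue_block n r j| <= (n %/ r).+1.
Proof.
case: r => [|r].
  rewrite divn0; apply/card_le1_eqP => x y; rewrite !inE !modn0 => /eqP hx /eqP hy.
  by apply/val_inj; rewrite /= hx hy.
pose f (i : 'I_n) : 'I_(n %/ r.+1).+1 := inord (i %/ r.+1).
have fE (i : 'I_n) : val (f i) = i %/ r.+1.
  by rewrite /f /= inordK // ltnS leq_div2r // ltnW.
rewrite -[X in _ <= X]card_ord -(card_in_imset (f := f)) ?max_card // => x y.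
rewrite !inE => /eqP hx /eqP hy /(congr1 val); rewrite !fE => hxy.
by apply/val_inj; rewrite /= (divn_eq x r.+1) (divn_eq y r.+1) hx hy hxy.
Qed.

(* Every clause has a literal made true by [a], so one of the [r] blocks of
   variables accounts for at least a fraction [1 / r] of the clauses. *)
Lemma good_block n r (a : assignment n) phi : 0 < r -> all (clause_sat a) phi ->
  exists2 j, j < r &
    r * size (restrict (subset_advice a (residue_block n r j)) phi) + size phi <=
      r * size phi.
Proof.
move=> r0 ha.
pose F j := count (forced (subset_advice a (residue_block n r j))) phi.
have hF : size phi <= \sum_(j < r) F j.
  rewrite /F {F}; elim: phi ha => // c phi IH /= /andP[hc /IH {}IH].
  rewrite big_split /= -add1n leq_add // {IH}.
  case/hasP: hc => l lc hl.
  have hj : l.1 %% r < r by rewrite ltn_mod.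
  rewrite (bigD1 (Ordinal hj)) //= (_ : forced _ _) //.
  by apply/hasP; exists l => //; rewrite ffunE inE eqxx (eqP hl).
have [j _ hj] : exists2 j : 'I_r, true & size phi <= r * F j.
  case: (boolP [exists j : 'I_r, size phi <= r * F j]) => [/existsP[j]|].
    by exists j.
  rewrite negb_exists => /forallP h.
  case: (posnP (size phi)) => [-> | s0]; first by exists (Ordinal r0).
  (* If every [r * F j] were below [size phi], summing over the [r] blocks would contradict [hF]. *)
  have : \sum_(j < r) (r * F j + 1) <= \sum_(j < r) size phi.
    by apply: leq_sum => j _; rewrite addn1 ltnNge h.
  rewrite big_split /= -big_distrr /= !sum_nat_const card_ord muln1;
    have := leq_mul (leqnn r) hF; set u := r * size phi; set v := r * \sum_(_ < _) _ => uv vu.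
  by exfalso; lia.
exists j => //; rewrite size_restrict.
have hc := count_predC (forced (subset_advice a (residue_block n r j))) phi.
by rewrite -[X in _ <= _ * X]hc mulnDr addnC leq_add2r.
Qed.

(** Entries grow at the head, so the induction builds [os] from its tail; the hypothesis keeps
    [q + 1] units available whenever a pair has to be charged. *)
Lemma mem_entries q B (os : seq (option bool * option bool)) :
  q.+1 * count (predC1 (None, None)) os <= B ->
  (unzip1 os, unzip2 os, B - q.+1 * count (predC1 (None, None)) os) \in
    iter (size os) (expand_all q) [:: ([::], [::], B)].
Proof.
elim: os => [|o os IH]; first by rewrite /= muln0 subn0 inE.
move=> h; have := IH; rewrite [count _ _]/= in h *.
set k := count _ os in h *; rewrite mulnDr in h *.
move=> /(_ (leq_trans (leq_addl _ _) h)) he.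
rewrite [size _]/= iterS /expand_all mem_rev; apply/flatten_mapP.
exists (unzip1 os, unzip2 os, B - q.+1 * k) => //.
case: (eqVneq o (None, None)) h => [-> _ | o0 h].
  by rewrite muln0 add0n /expand mem_head.
rewrite muln1 in h *.
have qb : q < B - q.+1 * k by lia.
rewrite /expand in_cons [_.2]/= qb; apply/orP; right.
apply/mapP; exists o; first by case: (o) => [[[]|] [[]|]].
by rewrite /grow [_.2]/= [unzip1 _]/= [unzip2 _]/=; congr (_, _, _); lia.
Qed.

(** An index where both strings are defined is charged once, so the sum of the support sizes bounds
    the charge. *)
Lemma card_le_entries q C n (t w : advice n) :
  q.+1 * (#|[set i | t i != None]| + #|[set i | w i != None]|) <= C + n ->
  exists2 e, e \in entries n q C & partial n e.1.1 = t /\ partial n e.1.2 = w.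
Proof.
move=> h; pose os := [seq (t i, w i) | i <- enum 'I_n].
have hos : q.+1 * count (predC1 (None, None)) os <= C + n.
  apply: leq_trans h; rewrite leq_mul2l; apply/orP; right.
  rewrite count_map enumT !cardsE !cardE !size_filter -count_predUI.
  rewrite (leq_trans _ (leq_addr _ _)) //; apply: sub_count => i /=.
  by rewrite !unfold_in /=; case: (t i); case: (w i).
exists (unzip1 os, unzip2 os, C + n - q.+1 * count (predC1 (None, None)) os).
  by rewrite /entries -[X in iter X](size_enum_ord) -(size_map (fun i => (t i, w i))) mem_entries.
have nthE (f : advice n) : partial n (map f (enum 'I_n)) = f.
  by apply/ffunP => i; rewrite ffunE (nth_map i) ?size_enum_ord // nth_ord_enum.
by split; rewrite -[RHS]nthE /= /os /unzip1 /unzip2 -map_comp.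
Qed.

Local Open Scope ring_scope.

(** * Real estimates *)

Section Fractions.
Variable R : realType.

(** Multiplying out covers the empty formula too, where both sides vanish. *)
Lemma frac_unsat n (b : assignment n) (phi : cnf3 n) :
  frac R b phi * (size phi)%:R =
  (size phi)%:R - (count (fun c => ~~ clause_sat b c) phi)%:R.
Proof.
rewrite /frac; case: phi => [|c phi]; first by rewrite /= mulr0 subrr.
set psi := c :: phi; rewrite divfK ?pnatr_eq0 //.
by rewrite -[in RHS](count_predC (clause_sat b) psi) natrD addrK.
Qed.

Lemma frac_eq1 n (b : assignment n) (phi : cnf3 n) :
  (frac R b phi == 1) = all (clause_sat b) phi.
Proof.
case: phi => [|c phi]; first by rewrite /frac eqxx.
set psi := c :: phi; have s0 : (size psi)%:R != 0 :> R by rewrite pnatr_eq0.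
have -> : frac R b psi = (count (clause_sat b) psi)%:R / (size psi)%:R by [].
by rewrite -(inj_eq (mulIf s0)) divfK // mul1r eqr_nat all_count.
Qed.

Lemma frac_le_sat n (b : assignment n) (phi : cnf3 n) : frac R b phi <= sat R phi.
Proof. exact: (le_bigmax _ (fun a : {ffun 'I_n -> bool} => frac R a phi)). Qed.

Lemma frac_le1 n (b : assignment n) (phi : cnf3 n) : frac R b phi <= 1.
Proof.
rewrite /frac; case: phi => [|c phi] //.
by rewrite ler_pdivrMr ?ltr0n // mul1r ler_nat count_size.
Qed.

Lemma sat_eq1P n (phi : cnf3 n) :
  sat R phi = 1 <-> exists a : assignment n, all (clause_sat a) phi.
Proof.
split=> [h|[a ha]].
  apply/existsP; apply: contraT; rewrite negb_exists => /forallP hn.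
  suff : sat R phi < 1 by rewrite h ltxx.
  apply/bigmax_ltP; split=> // a _.
  by rewrite lt_neqAle frac_eq1 hn frac_le1.
apply/eqP; rewrite eq_le; apply/andP; split.
  by apply/bigmax_leP; split=> // b _; apply: frac_le1.
have := ha; rewrite -frac_eq1 => /eqP <-; exact: frac_le_sat.
Qed.
End Fractions.

Section Estimates.
Variable R : realType.

Lemma bernoulli (x : R) k : -1 <= x -> 1 + k%:R * x <= (1 + x) ^+ k.
Proof.
move=> hx; elim: k => [|k IH]; first by rewrite mul0r addr0 expr0.
have h0 : 0 <= 1 + x by lra.
rewrite exprS; apply: le_trans (ler_wpM2l h0 IH).
rewrite -subr_ge0 -natr1; set t := k%:R.
have -> : (1 + x) * (1 + t * x) - (1 + (t + 1) * x) = t * x ^+ 2 by ring.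
by rewrite mulr_ge0 ?sqr_ge0.
Qed.

Lemma exp_unbounded (y M : R) : 1 < y -> exists k, M <= y ^+ k.
Proof.
move=> y1; exists (Num.truncn (M / (y - 1))).+1.
have h := @bernoulli (y - 1) (Num.truncn (M / (y - 1))).+1.
rewrite [1 + (y - 1)]addrC subrK in h; apply: le_trans (h _); last by lra.
have y0 : 0 < y - 1 by lra.
have : M / (y - 1) < (Num.truncn (M / (y - 1))).+1%:R by exact: truncnS_gt.
by rewrite ltr_pdivrMr // => /ltW; lra.
Qed.

(** With [z] the [(e + 1)]-th root of [y], Bernoulli gives [n + 1 <= K1 * z ^ n]; raise this to the
    power [e] and use [z ^ e <= y]. Taking [e + 1] avoids dividing by zero. *)
Lemma poly_le_exp (y : R) e : 1 < y ->
  exists2 K, 0 <= K & forall n, n.+1%:R ^+ e <= K * y ^+ n.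
Proof.
move=> y1; pose z := y `^ (e.+1%:R)^-1.
have zy : z ^+ e.+1 = y.
  by rewrite -powR_mulrn ?powR_ge0 // -powRrM mulVf ?pnatr_eq0 // powRr1 //; lra.
have z1 : 1 < z.
  rewrite ltNge; apply/negP => hz; have : y <= 1.
    by rewrite -zy exprn_ile1 ?powR_ge0.
  by lra.
have z0 : 0 < z - 1 by lra.
pose K1 := 1 + (z - 1)^-1.
have K0 : 0 <= K1 by rewrite addr_ge0 // invr_ge0 ltW.
exists (K1 ^+ e) => [|n]; first exact: exprn_ge0.
have hn : n.+1%:R <= K1 * z ^+ n.
  have h := @bernoulli (z - 1) n; rewrite [1 + (z - 1)]addrC subrK in h.
  apply: le_trans (ler_wpM2l K0 (h _)); last by lra.
  rewrite -natr1 /K1 -subr_ge0; set u := z - 1; set t := n%:R.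
  have -> : (1 + u^-1) * (1 + t * u) - (t + 1) = t * u + u^-1.
    by field; rewrite lt0r_neq0.
  by rewrite addr_ge0 ?invr_ge0 ?mulr_ge0 // ltW.
apply: (@le_trans _ _ ((K1 * z ^+ n) ^+ e)).
  by rewrite lerXn2r // nnegrE ?mulr_ge0 ?exprn_ge0 // powR_ge0.
rewrite exprMn ler_wpM2l ?exprn_ge0 // -exprM mulnC exprM lerXn2r ?nnegrE //.
- by rewrite exprn_ge0 // powR_ge0.
- by lra.
- by rewrite -[leRHS]zy ler_eXn2l.
Qed.

(** The binomial theorem, indexed by the set of factors in which [x] is chosen. *)
Lemma sum_subsets (x y : R) n :
  \sum_(S : {set 'I_n}) x ^+ #|S| * y ^+ (n - #|S|) = (x + y) ^+ n.
Proof.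
rewrite -[in RHS](card_ord n) -prodr_const bigA_distr /=; apply: eq_bigr => S _.
rewrite (bigID (fun i => i \in S)) /=; congr (_ * _).
  by rewrite (eq_bigr (fun=> x)) ?prodr_const // => i ->.
rewrite (eq_bigr (fun=> y)) => [|i /negbTE -> //].
rewrite prodr_const; congr (_ ^+ _); have := cardsC S; rewrite card_ord => h.
transitivity #|~: S|; first by rewrite -[X in (X - _)%N]h addKn.
by apply: eq_card => i; rewrite !inE.
Qed.

(* Markov's inequality for [2 ^ #|S|], whose expectation is [(1 + eps) ^ n]. *)
Lemma subset_prob_le (eps : R) n k (E : {set 'I_n} -> Prop) :
  0 <= eps <= 1 -> (forall S, E S -> k < #|S|)%N ->
  subset_prob eps E <= (1 + eps) ^+ n / 2 ^+ k.+1.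
Proof.
move=> /andP[e0 e1] hE; rewrite /subset_prob.
have -> : (1 + eps) ^+ n = (2 * eps + (1 - eps)) ^+ n by congr (_ ^+ _); ring.
rewrite ler_pdivlMr ?exprn_gt0 // -(sum_subsets (2 * eps)) mulr_suml big_mkcond /=.
apply: ler_sum => S _; case: ifP => [/asboolP /hE kS|_].
  rewrite exprMn mulrAC ler_wpM2r ?exprn_ge0 ?subr_ge0 // mulrC ler_wpM2r ?exprn_ge0 //.
  by rewrite ler_eXn2l // ltr1n.
by rewrite mulr_ge0 ?exprn_ge0 ?mulr_ge0 ?subr_ge0.
Qed.

(** Otherwise [E] forces [n %/ r + C < #|S|], and Markov's bound with
    [(1 + eps) ^ n <= 2 ^ (n %/ r + 1)] gives [p * 2 ^ C <= 1]. *)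
Lemma exists_small_subset (eps p : R) r C n (E : {set 'I_n} -> Prop) :
  (0 < r)%N -> 0 <= eps <= 1 -> eps * (2 * r)%:R <= 1 -> 1 < p * 2 ^+ C ->
  p <= subset_prob eps E -> exists2 S, E S & (#|S| <= n %/ r + C)%N.
Proof.
move=> r0 he er hp hE; apply: contrapT => hn.
have hk S : E S -> (n %/ r + C < #|S|)%N.
  by move=> ES; rewrite ltnNge; apply/negP => le; apply: hn; exists S.
have := le_trans hE (subset_prob_le he hk).
have /andP[e0 e1] := he.
(* Bernoulli gives [1 / 2 <= (1 - eps) ^ r], and [(1 + eps) * (1 - eps) <= 1] turns this into an
   upper bound. *)
have h2 : (1 + eps) ^+ r <= 2.
  have hb := @bernoulli (- eps) r.
  have h1 : 2^-1 <= (1 - eps) ^+ r.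
    apply: le_trans (hb _); last by lra.
    by move: er; rewrite natrM; set t := r%:R; nra.
  have : (1 + eps) ^+ r * (1 - eps) ^+ r <= 1.
    rewrite -exprMn exprn_ile1 //; first by rewrite mulr_ge0 ?subr_ge0 ?addr_ge0.
    by nra.
  have : (1 + eps) ^+ r * 2^-1 <= (1 + eps) ^+ r * (1 - eps) ^+ r.
    by rewrite ler_wpM2l // exprn_ge0 // addr_ge0.
  by lra.
have hn' : (1 + eps) ^+ n <= 2 ^+ (n %/ r).+1.
  apply: (@le_trans _ _ ((1 + eps) ^+ (r * (n %/ r).+1))).
    by rewrite ler_weXn2l ?lerDl // mulnC ltnW // ltn_ceil.
  by rewrite exprM lerXn2r // nnegrE ?exprn_ge0 ?addr_ge0.
rewrite ler_pdivlMr ?exprn_gt0 // => /le_trans /(_ hn').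
rewrite -addSn exprD mulrCA -[leRHS]mulr1 ler_pM2l ?exprn_gt0 //.
by rewrite leNgt hp.
Qed.

(* The potential [y ^ budget] grows by at most a factor [y] in each round, as an
   entry has at most [9] children with budget smaller by [q + 1]. *)
Lemma sum_expand_all (y : R) q L : 1 <= y -> 9 <= y ^+ q.+1 * (y - 1) ->
  \sum_(e <- expand_all q L) y ^+ e.2 <= y * \sum_(e <- L) y ^+ e.2.
Proof.
move=> y1 hy; rewrite /expand_all (perm_big _ (permEl (perm_rev _))) /=.
have y0 : 0 <= y by lra.
rewrite big_flatten big_map mulr_sumr /=; apply: ler_sum => e _.
rewrite /expand big_cons [_.2]/=; case: ifP => [qe|_]; last first.
  by rewrite big_nil addr0 ler_peMl ?exprn_ge0.
rewrite big_map /options /= !big_cons big_nil [_.2]/=.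
have -> : y ^+ e.2 = y ^+ (e.2 - q.+1) * y ^+ q.+1 by rewrite -exprD subnK.
have : 0 <= y ^+ (e.2 - q.+1) by rewrite exprn_ge0.
move: hy; set u := y ^+ (_ - _); set v := y ^+ q.+1 => hy u0.
have := ler_wpM2l u0 hy; lra.
Qed.

(** Each entry has potential at least [1]; the potential starts at [y ^ (C + n)] and gains at most a
    factor [y] in each of [n] rounds. *)
Lemma size_entries_le (y : R) n q C : 1 <= y -> 9 <= y ^+ q.+1 * (y - 1) ->
  (size (entries n q C))%:R <= y ^+ C * (y ^+ n * y ^+ n).
Proof.
move=> y1 hy; have y0 : 0 <= y by lra.
apply: (@le_trans _ _ (\sum_(e <- entries n q C) y ^+ e.2)).
  elim: (entries n q C) => [|e L IH]; first by rewrite big_nil.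
  by rewrite big_cons /= -add1n natrD lerD // exprn_ege1.
rewrite mulrCA -exprD /entries; set L0 := [:: _].
have -> : y ^+ (C + n) = \sum_(e <- L0) y ^+ e.2 by rewrite big_seq1.
elim: {1 2}n => [|j IH]; first by rewrite mul1r.
rewrite iterS exprS -mulrA; apply: le_trans (sum_expand_all _ y1 hy) _.
by rewrite ler_wpM2l.
Qed.

(** Once [D > 1 / (z - x)], the interval from [x * D] to [z * D] is longer than [1], so it contains
    an integer below its right end. *)
Lemma between_fractions (x z : R) : 0 <= x -> x < z ->
  exists P D : nat, x * D%:R <= P%:R /\ P%:R < z * D%:R.
Proof.
move=> x0 xz; pose D := (Num.truncn (z - x)^-1).+1.
have hD : 1 < (z - x) * D%:R.
  have := truncnS_gt (z - x)^-1; rewrite -/D.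
  by rewrite -[_^-1]mul1r ltr_pdivrMr ?subr_gt0 // mulrC.
exists (Num.truncn (x * D%:R)).+1, D; split; first exact/ltW/truncnS_gt.
have h0 : 0 <= x * D%:R by rewrite mulr_ge0.
have := truncn_le (x * D%:R); rewrite h0 -natr1; lra.
Qed.
End Estimates.

Local Close Scope ring_scope.

(** * Encoding sizes, running time and soundness *)

Lemma tree_size_enc_seq (T : Type) (f : T -> tree) xs B :
  (forall x, tree_size (f x) <= B) ->
  tree_size (enc_seq (map f xs)) <= size xs * B.+1 + 1.
Proof.
by move=> hB; elim: xs => //= x xs IH; have := hB x; rewrite mulSn; lia.
Qed.

Lemma tree_size_enc_nat j : tree_size (enc_nat j) = j * 2 + 1.
Proof. by elim: j => //= j; rewrite /enc_nat => ->; lia. Qed.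

Lemma tree_size_enc_input n (phi : cnf3 n) w :
  tree_size (enc_input phi w) <= 40 * (n.+1 * (size phi).+1).
Proof.
have hl (l : literal n) : tree_size (enc_literal l) <= 2 * n + 5.
  by rewrite /= tree_size_enc_nat; have := ltn_ord l.1; case: (l.2) => /=; lia.
have hc (c : clause n) : tree_size (enc_clause c) <= 6 * n + 20.
  by apply: leq_trans (tree_size_enc_seq _ hl) _; have := size_bseq c; nia.
have ho (i : 'I_n) : tree_size (enc_option_bool (w i)) <= 5 by case: (w i) => [[]|].
have TN l r : tree_size (Node l r) = (tree_size l + tree_size r).+1 by [].
rewrite /enc_input /enc_cnf !TN tree_size_enc_nat.
have := tree_size_enc_seq phi hc; have := tree_size_enc_seq (enum 'I_n) ho.
rewrite size_enum_ord; set u := tree_size _; set v := tree_size _.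
by move: (size phi) => m; nia.
Qed.

(** Linear costs are absorbed by [z], the time of [A] by [z ^ k], and both by [z ^ k.+1]; [L.+1]
    instead of [L] pays for the work outside the loop over entries. *)
Lemma search_time_le (A : cmd) (P D q C k L n z : nat) (phi : cnf3 n) :
  z = n.+1 * (size phi).+1 ->
  L * (n * (20 * (q + 50) + 10) + try_time A P D phi (k * (40 * z) ^ k) + 10) +
    n * 20 + C * 2 + 100 <=
  L.+1 * (((20 * (q + 50) + 3 * P + D + cmd_bound A * 3 + C * 2 + 1100) +
            k * 40 ^ k) * z ^ k.+1).
Proof.
rewrite /try_time expnMn; move: (size phi) => m zm.
set K := _ + 1100; set w := z ^ k; set k40 := 40 ^ k.
have w0 : 0 < w by rewrite expn_gt0 zm.
have zE : z = n * m + n + m + 1 by rewrite zm; lia.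
have zw : z <= z ^ k.+1 by rewrite expnS leq_pmulr.
have ww : w <= z ^ k.+1 by rewrite expnS leq_pmull // zE; lia.
have nz a : n * a <= a * z by rewrite mulnC leq_mul2l zE; lia.
have mz a : m * a <= a * z by rewrite mulnC leq_mul2l zE; lia.
have cz a : a <= a * z by rewrite leq_pmulr // zE; lia.
have nmz : m * (78 * n) <= 78 * z by rewrite zE; lia.
have h1 : n * (20 * (q + 50) + 10) +
    (m * (78 * n + 3 * P + D + 600) + (cmd_bound A * 3 + 0 + 300)) + 10 <= K * z.
  rewrite /K; move: (nz (20 * (q + 50) + 10)) (mz (3 * P + D + 600)) nmz.
  move: (cz (cmd_bound A * 3 + 310)) (cz (C * 2)).
  by rewrite !(mulnDl, mulnDr); lia.
have h2 : n * 20 + C * 2 + 100 <= K * z.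
  by move: (nz 20) (cz (C * 2)) (cz 100); rewrite /K !mulnDl; lia.
have h3 : K * z <= K * z ^ k.+1 by rewrite leq_mul2l zw orbT.
have h4 : k * (k40 * w) <= k * k40 * z ^ k.+1 by rewrite mulnA leq_mul2l ww orbT.
rewrite mulnDl mulSn -!addnA addnC leq_add //.
  rewrite !addnA in h2 *.
  by move: h2 h3; lia.
rewrite leq_mul2l; apply/orP; right.
by move: h1 h3 h4; lia.
Qed.

(** Acceptance certifies itself: whatever tree [out] returned, [patch sigma b] falsifies no more
    clauses of [phi] than were counted. *)
Lemma accepts_unsat P D n (phi : cnf3 n) out e : accepts P D phi out e ->
  exists b : assignment n,
    D * count (fun c => ~~ clause_sat b c) phi <= P * size phi.
Proof.
rewrite /accepts size_restrict; set sigma := partial n _; set b := read_bits _ _ => h.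
exists (patch sigma b); rewrite -count_restrict; apply: leq_trans h.
by rewrite leq_mul2l; apply/orP; right; apply: sub_count.
Qed.

Lemma read_bits_enc n (b : assignment n) : read_bits n (enc_assignment b) = b.
Proof.
apply/ffunP => i; rewrite ffunE hd_iter_tl (nth_map i) ?size_enum_ord //.
by rewrite nth_ord_enum; case: (b i).
Qed.

(** * Choice of parameters and correctness of the reduction *)

Local Open Scope ring_scope.

Theorem mainTheorem7 (R : realType) (delta gamma : R) :
  0 < delta -> 0 < gamma -> gap_ETH delta gamma ->
  exists eps0 : R, 0 < eps0 /\
    forall eps : R, 0 <= eps <= 1 -> eps <= eps0 ->
    forall p : R, 0 < p ->
      ~ exists A : cmd,
          polytime_with_advice A /\ solves_with_subset_advice gamma eps p A.
Proof.
move=> d0 g0 eth.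
(* The running time uses three factors [y ^ n], two for the number of entries and one for polynomial
   terms; [3 <= 8] leaves slack. *)
pose y : R := 2 `^ (delta / 8).
have y1 : 1 < y.
  have := @gt0_ltr_powR R (delta / 8) (divr_gt0 d0 _) 1 2.
  by rewrite powR1; apply; rewrite ?nnegrE ?ltr1n.
have y0 : 0 < y by apply: lt_trans y1.
(* The nine children with budget lowered by [q + 1] then have total potential at most [y - 1] times
   that of the parent. *)
have [q hq] : exists q, 9 <= y ^+ q.+1 * (y - 1).
  have [q hq] := exp_unbounded (9 / (y - 1)) y1.
  exists q; rewrite -ler_pdivrMr ?subr_gt0 //; apply: le_trans hq _.
  by rewrite ler_weXn2l ?(ltW y1).
(* Block and advice subset each have [n %/ r] elements up to a constant; this [r] makes their joint
   charge [q.+1 * (2 * (n %/ r))] at most [n]. *)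
pose r := (2 * q.+1)%N.
have r0 : 0 < r%:R :> R by rewrite ltr0n.
exists ((2 * r)%:R^-1); split; first by rewrite invr_gt0 ltr0n.
move=> eps he he0 p p0 [A [[k polyA] solA]]; apply: eth.
have [C0 hC0] : exists C0, 1 < p * 2 ^+ C0.
  have [C0 hC0] := exp_unbounded (p^-1 + 1) (ltr1n R 2).
  exists C0; rewrite mulrC -ltr_pdivrMr // mul1r; apply: lt_le_trans hC0.
  by rewrite ltrDl.
have [P [D [hP1 hP2]]] : exists P D : nat,
    gamma * (1 - r%:R^-1) * D%:R <= P%:R /\ P%:R < gamma * D%:R.
  apply: between_fractions.
    by rewrite mulr_ge0 ?(ltW g0) // subr_ge0 invf_le1 // ler1n.
  by rewrite gtr_pMr // ltrBlDr ltrDl invr_gt0.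
(* Pays for the additive terms: one index for the block and [C0] for the random subset. *)
pose C := (q.+1 * C0.+1)%N.
exists (search_cmd A q C P D) => c.
have [K2 K20 hK2] := poly_le_exp (c.+1 * k.+1) y1.
pose K0 := (20 * (q + 50) + 3 * P + D + cmd_bound A * 3 + C * 2 + 1100 + k * 40 ^ k)%N.
exists (2 * y ^+ C * (K0 * c.+1 ^ k.+1)%:R * K2) => n phi hphi.
have /choice[out outP] (x : cnf3 n * advice n) : exists o, exists2 t,
    computes A (enc_input x.1 x.2) t o & (t <= k * tree_size (enc_input x.1 x.2) ^ k)%N.
  by have [t [o [h1 h2]]] := polyA n x.1 x.2; exists o, t.
pose z := (n.+1 * (size phi).+1)%N.
have outT psi w : (size psi <= size phi)%N ->
    exists2 t, computes A (enc_input psi w) t (out (psi, w)) & (t <= k * (40 * z) ^ k)%N.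
  move=> hs; have [t h1 h2] := outP (psi, w); exists t => //; apply: leq_trans h2 _.
  rewrite leq_mul2l; apply/orP; right.
  have h : (tree_size (enc_input psi w) <= 40 * z)%N.
    by apply: leq_trans (tree_size_enc_input _ _) _; rewrite /z !leq_mul2l /= ltnS hs.
  by case: (k) => // k'; rewrite leq_exp2r.
have [t [s [hx ht hs]]] := runs_search_cmd P D outT q C.
exists t, (enc_bool (has (accepts P D phi out) (entries n q C))); split.
- by exists s.
- have {}ht := leq_trans ht (search_time_le A P D q C k (size (entries n q C)) (erefl z)).
  have hz : (z ^ k.+1 <= c.+1 ^ k.+1 * n.+1 ^ (c.+1 * k.+1))%N.
    rewrite expnM -expnMn leq_exp2r // /z expnS mulnCA leq_mul2l /=.
    apply: leq_trans (_ : (c * n.+1 ^ c).+1 <= _)%N; first by rewrite ltnS.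
    by rewrite mulSn -add1n leq_add2r expn_gt0.
  have hL : (size (entries n q C)).+1%:R <= 2 * y ^+ C * (y ^+ n * y ^+ n).
    have := size_entries_le n C (ltW y1) hq; rewrite -natr1.
    have : 1 <= y ^+ C * (y ^+ n * y ^+ n) by rewrite -!exprD exprn_ege1 ?(ltW y1).
    lra.
  have hy : y ^+ n * y ^+ n * y ^+ n <= 2 `^ (delta * n%:R).
    have -> : delta * n%:R = delta / 8 * (8 * n)%:R :> R by rewrite natrM; field.
    rewrite powRrM -/y (powR_mulrn (8 * n) (ltW y0)) -!exprD.
    apply: ler_weXn2l; first exact: ltW.
    by clear; lia.
  have hZ : (K0 * z ^ k.+1)%:R <= (K0 * c.+1 ^ k.+1)%:R * (K2 * y ^+ n).
    rewrite natrM [(K0 * _)%:R]natrM -mulrA ler_wpM2l // .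
    apply: (@le_trans _ _ (c.+1 ^ k.+1 * n.+1 ^ (c.+1 * k.+1))%:R); first by rewrite ler_nat.
    by rewrite natrM [(n.+1 ^ _)%:R]natrX ler_wpM2l.
  apply: (@le_trans _ _ ((size (entries n q C)).+1 * (K0 * z ^ k.+1))%:R).
    by rewrite ler_nat.
  rewrite natrM; apply: le_trans (ler_pM _ _ hL hZ) _ => //.
  set a := (K0 * _)%:R.
  have -> : 2 * y ^+ C * (y ^+ n * y ^+ n) * (a * (K2 * y ^+ n)) =
      2 * y ^+ C * a * K2 * (y ^+ n * y ^+ n * y ^+ n) by ring.
  by rewrite ler_wpM2l // !mulr_ge0 ?exprn_ge0 ?(ltW y0).
- move=> /sat_eq1P[a ha]; congr enc_bool.
  have rn0 : (0 < r)%N by [].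
  have [j jr hj] := good_block rn0 ha.
  set tau := subset_advice a _ in hj; set psi := restrict tau phi in hj.
  have hpsi : all (clause_sat a) psi.
    apply: satisfies_restrict ha => i v; rewrite ffunE; case: ifP => // _ [->] //.
  have sat1 : sat R psi = 1 by apply/sat_eq1P; exists a.
  have fr1 : frac R a psi = sat R psi by rewrite sat1; apply/eqP; rewrite frac_eq1.
  have er : eps * (2 * r)%:R <= 1 by rewrite -ler_pdivlMr ?ltr0n // mul1r.
  (* [a] is also optimal for [psi], so the guarantee on [A] applies to the restricted formula with
     advice taken from [a]. *)
  have [S [t' [b [hb1 hb2]]] hS] :=
    exists_small_subset rn0 he er hC0 (solA n psi sat1 a fr1).
  set w := subset_advice a S in hb1.
  have supp (T : {set 'I_n}) : [set i | subset_advice a T i != None] = T.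
    by apply/setP => i; rewrite inE ffunE; case: (i \in T).
  have [|e he' [he1 he2]] := @card_le_entries q C n tau w.
    rewrite !supp; have := card_residue_block n r j.
    have := leq_trunc_div n r; move: hS; rewrite /C /r.
    move: (n %/ _)%N #|S| #|residue_block _ _ _| => d u v; clear.
    move=> h1 h2 h3; apply: (@leq_trans (q.+1 * (d.+1 + (d + C0)))%N).
      by rewrite leq_mul2l leq_add.
    by move: h2; clear; lia.
  apply/hasP; exists e => //; rewrite /accepts he1 he2 -/psi.
  have [t2 [s2 [x2 o2]] _] := outP (psi, w).
  have [s1 [x1 o1]] := hb1.
  have -> : out (psi, w) = enc_assignment b by rewrite -o1 -o2 (exec_det x1 x2).
  rewrite read_bits_enc size_restrict.
  have := frac_unsat R b psi.
  rewrite (eq_count (a2 := fun c => ~~ clause_sat b c)) //.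
  set u := count _ psi => hu.
  have hu' : u%:R <= gamma * (size psi)%:R :> R.
    have := ler_wpM2r (ler0n R (size psi)) hb2; rewrite hu; lra.
  have hj' : (size psi)%:R <= (1 - r%:R^-1) * (size phi)%:R :> R.
    have : (r * size psi + size phi)%:R <= (r * size phi)%:R :> R by rewrite ler_nat.
    rewrite natrD (natrM _ r) (natrM _ r) => h.
    by rewrite -(ler_pM2l r0) mulrA mulrBr mulr1 divff ?lt0r_neq0 // mulrBl mul1r lerBrDr.
  rewrite -(ler_nat R) !natrM.
  apply: le_trans (ler_wpM2l (ler0n _ D) hu') _.
  apply: (@le_trans _ _ (D%:R * (gamma * ((1 - r%:R^-1) * (size phi)%:R)))).
    by rewrite !ler_wpM2l ?(ltW g0).
  have -> : D%:R * (gamma * ((1 - r%:R^-1) * (size phi)%:R)) =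
    gamma * (1 - r%:R^-1) * D%:R * (size phi)%:R by ring.
  by rewrite ler_wpM2r.
- move=> hsat; congr enc_bool; apply/negbTE/negP => /hasP[e _ /accepts_unsat[b hb]].
  have := le_trans (frac_le_sat R b phi) hsat => hf.
  (* The empty formula is excluded, its fraction [1] exceeding [1 - gamma]. *)
  have hn : 0 < (size phi)%:R :> R.
    rewrite ltr0n; case: (phi) hf => // hf.
    by move: hf; rewrite /frac /=; lra.
  have := ler_wpM2r (ltW hn) hf; rewrite frac_unsat; set u := count _ _ in hb * => hu.
  move: hb; rewrite -(ler_nat R) !natrM => hb.
  have D0 : 0 < D%:R :> R.
    rewrite ltr0n lt0n; apply/negP => /eqP D0.
    by move: hP2; rewrite D0 mulr0 ltNge ler0n.
  (* With [m] the number of clauses, acceptance would give [gamma D m <= D u <= P m < gamma D m]. *)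
  have h1 : gamma * (size phi)%:R <= u%:R by lra.
  have h2 := ler_wpM2l (ltW D0) h1.
  have h3 : P%:R * (size phi)%:R < gamma * D%:R * (size phi)%:R by rewrite ltr_pM2r.
  lra.
Qed.
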